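(* Let $H$ be a complex Hilbert space, let $L_0$ be a (densely defined) symmetric minimal operator in $H$, let $\widehat{L}=L_0^*$ be the corresponding maximal operator, let $L$ be a self-adjoint correct extension of $L_0$, and let $L_K$ be a correct restriction of $\widehat{L}$, with $$L_K^{-1}f=L^{-1}f+Kf,\qquad f\in H,$$ where $K$ is a bounded linear operator on $H$ with $R(K)\subset \operatorname{Ker}\widehat{L}$. Suppose $R(K^* )\subset D(L)$. Then the following hold for the adjoint $L_K^*$. (i) If $I+KL\ge 0$ and $I+KL$ is invertible, then $L_K^*$ is similar to a self-adjoint operator. (ii) If $I+KL\ge 0$ and $I+KL$ is invertible, then $\sigma(L_K^* )\subset\mathbb{R}$. (iii) If $I+KL\ge 0$, $I+KL$ is invertible, and $L^{-1}$ is a compact operator, then the system of eigenvectors of $L_K^*$ forms a Riesz basis in $H$. (iv) If $KL\ge 0$, then $L_K^*$ is similar to a self-adjoint operator.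
   Context: $D(\cdot)$, $R(\cdot)$, $\operatorname{Ker}$ denote domain, range and kernel; $I$ is the identity on $H$. A linear operator $A$ in $H$ is correctly solvable if there is $C>0$ with $\|u\|\le C\|Au\|$ for all $u\in D(A)$, and everywhere solvable if $R(A)=H$; $A$ is a correct operator if both hold (so $A^{-1}$ is a bounded operator defined on all of $H$). A correctly solvable operator $L_0$ is minimal if $\overline{R(L_0)}\ne H$. A closed operator $\widehat{L}$ is maximal if $R(\widehat{L})=H$ and $\operatorname{Ker}\widehat{L}\neq\{0\}$. $A$ is a restriction of $B$ (and $B$ an extension of $A$) if $D(A)\subset D(B)$ and $Au=Bu$ for $u\in D(A)$. A correct extension of $L_0$ (correct restriction of $\widehat L$) is an extension of $L_0$ (restriction of $\widehat L$) that is a correct operator. Every correct restriction $L_K$ of $\widehat{L}$ has inverse $L_K^{-1}=L^{-1}+K$ for a bounded linear operator $K$ from $H$ into $\operatorname{Ker}\widehat{L}$, and then $D(L_K)=\{u\in D(\widehat{L}): (I-K\widehat{L})u\in D(L)\}$. The domain $D(L_K)$ is dense in $H$ if and only if $\operatorname{Ker}(I+K^*L^* )=\{0\}$, and in that case $(L_K^* )^{-1}=(L_K^{-1})^*=(L^* )^{-1}+K^*$. When $R(K^* )\subset D(L)$ (with $L=L^*$), the operator $KL$, defined on the dense set $D(L)$, is bounded there; $KL$ denotes its bounded extension (closure) to all of $H$. For a bounded operator $T$ on $H$, $T\ge 0$ means $(Tx,x)\ge 0$ for all $x\in H$, and invertible means having a bounded inverse defined on all of $H$. A (possibly unbounded)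 operator $A$ is similar to $B$ if $A=SBS^{-1}$ (with equality of domains, $D(A)=S\,D(B)$) for some bounded, boundedly invertible operator $S$ on $H$. A Riesz basis of $H$ is the image of an orthonormal basis of $H$ under a bounded, boundedly invertible operator on $H$. As usual, ''the system of eigenvectors forms a Riesz basis'' means that, with a suitable choice of basis in each eigenspace and suitable normalization, the eigenvectors form a Riesz basis, i.e. there is a Riesz basis of $H$ consisting of eigenvectors. *)

(* Defs.v *)
From HB Require Import structures.
From mathcomp Require Import all_boot all_order all_algebra.
From mathcomp Require Import all_classical all_reals all_analysis.
From mathcomp Require Export complex.

Set Implicit Arguments.
Unset Strict Implicit.
Unset Printing Implicit Defensive.

Import Order.TTheory GRing.Theory Num.Theory.
Import numFieldNormedType.Exports.

Local Open Scope classical_set_scope.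
Local Open Scope complex_scope.
Local Open Scope ring_scope.

(* Possibly unbounded operators in [H] are represented by their graphs, i.e.
   by sets of pairs [(u, A u)] with [u] in the domain, so that equality of
   graphs is equality of operators including their domains. *)
Section Graphs.
Variables (R : realType) (H : completeNormedModType R[i]).
Implicit Types (A B T S G : set (H * H)) (E F : set H).

Definition is_operator A : Prop :=
  [/\ A (0, 0),
      forall (a : R[i]) (p q : H * H), A p -> A q -> A (a *: p + q) &
      forall v : H, A (0, v) -> v = 0].

Definition gdom A : set H := fst @` A.
Definition gran A : set H := snd @` A.
Definition gker A : set H := [set u | A (u, 0)].

Definition graph_of (f : H -> H) : set (H * H) := [set p | p.2 = f p.1].
Definition gid : set (H * H) := graph_of id.
Definition ginv A : set (H * H) := [set p | A (p.2, p.1)].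
Definition gcomp A B : set (H * H) :=
  [set p | exists2 y, B (p.1, y) & A (y, p.2)].
Definition gadd A B : set (H * H) :=
  [set p | exists y z, [/\ A (p.1, y), B (p.1, z) & p.2 = y + z]].

(* For linear maps between normed modules, [continuous] is equivalent to
   boundedness: [linear_bounded_continuous]. *)
Definition bounded_operator T : Prop :=
  exists f : {linear H -> H}, continuous f /\ T = graph_of f.

Definition boundedly_invertible T : Prop := bounded_operator (ginv T).

Definition correctly_solvable A : Prop :=
  exists2 C : R[i], 0 < C & forall u v, A (u, v) -> `|u| <= C * `|v|.

Definition everywhere_solvable A : Prop := gran A = setT.

Definition correct_operator A : Prop :=
  [/\ is_operator A, correctly_solvable A & everywhere_solvable A].

Definition minimal_operator A : Prop :=
  [/\ is_operator A, correctly_solvable A & closure (gran A) <> setT].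

Definition maximal_operator A : Prop :=
  [/\ is_operator A, closed A, gran A = setT & gker A <> [set 0]].

Definition restriction A B : Prop := A `<=` B.
Definition extension A B : Prop := restriction B A.

Definition correct_extension A B : Prop := extension A B /\ correct_operator A.
Definition correct_restriction A B : Prop := restriction A B /\ correct_operator A.

Definition similar_operators A B : Prop :=
  exists S, [/\ bounded_operator S, boundedly_invertible S &
                A = gcomp S (gcomp B (ginv S))].

Definition resolvent_set A : set R[i] :=
  [set z | bounded_operator (ginv (gadd A (graph_of (fun x => - (z *: x)))))].
Definition spectrum A : set R[i] := ~` resolvent_set A.

Definition eigenvector A (u : H) : Prop :=
  u <> 0 /\ exists z : R[i], A (u, z *: u).

(* The image of the closed unit ball is relatively compact. *)
Definition compact_operator T : Prop :=
  bounded_operator T /\ precompact (snd @` (T `&` [set p | `|p.1| <= 1])).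

Definition lspan E : set H :=
  [set x | exists s : seq (R[i] * H),
     (forall p, p \in s -> E p.2) /\ x = \sum_(p <- s) p.1 *: p.2].

Variable ip : {dot H for Num.conj}.

(* [(v, w)] is in [adjoint A] iff [(A u, v) = (u, w)] for all [u] in the domain
   of [A].  This is an operator exactly when [gdom A] is dense. *)
Definition adjoint A : set (H * H) :=
  [set p | forall u v, A (u, v) -> ip v p.1 = ip u p.2].

Definition densely_defined A : Prop := dense (gdom A).

Definition symmetric_operator A : Prop :=
  [/\ is_operator A, densely_defined A & A `<=` adjoint A].

Definition self_adjoint A : Prop :=
  [/\ is_operator A, densely_defined A & adjoint A = A].

Definition nonneg_operator T : Prop := forall x y, T (x, y) -> 0 <= ip y x.

Definition orthonormal_basis E : Prop :=
  [/\ forall x, E x -> ip x x = 1,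
      forall x y, E x -> E y -> x <> y -> ip x y = 0 &
      closure (lspan E) = setT].

Definition riesz_basis F : Prop :=
  exists E, exists S : {linear H -> H},
    [/\ orthonormal_basis E, continuous S, boundedly_invertible (graph_of S) &
        F = S @` E].

End Graphs.

Arguments gid {R} H _ : assert.

(* Main.v *)
From HB Require Import structures.
Require Import Defs.
From mathcomp Require Import all_boot all_order all_algebra.
From mathcomp Require Import all_classical all_reals all_analysis.
From mathcomp Require Import complex ring lra.

Import Order.TTheory GRing.Theory Num.Theory.
Import numFieldNormedType.Exports.

Local Open Scope classical_set_scope.
Local Open Scope complex_scope.
Local Open Scope ring_scope.

(** Write [G] for the bounded self-adjoint inverse of [L].  Then
    [L_K^-1 = G + K].  Since [K^*] maps into the range of [G], [K^* = G W] for
    an everywhere defined [W], and the uniform boundedness principle makes [W]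
    bounded; [B := W^*] is bounded and satisfies [B G = K], so that [B] is the
    closure of [K L] ([bounded_left_quotient], [closure_graph]).  With
    [P := I + B] this reads [L_K^-1 = P G], hence
    [L_K^* = (G P)^-1] as soon as [P] is symmetric ([adjoint_ginv_product]),
    and on a complex space [P >= 0] implies symmetry
    ([symmetric_op_of_real]).

    In each of the four parts [P] is bounded below by a positive constant: if
    [P >= 0] is invertible this is the Cauchy-Schwarz inequality for the form
    of [P] ([nonneg_invertible_coercive]), and if [B >= 0] then [P >= I].  So
    [P = T^2] with [T] symmetric, bounded and boundedly invertible
    ([positive_sqrt]), and [G P = T^-1 C T] with [C := T G T].  Therefore
    [L_K^* = T^-1 C^-1 T], and [C^-1] is self-adjoint because [C] is bounded,
    symmetric and injective with dense range ([self_adjoint_ginv]).  The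
    spectrum is real since [C - w] is invertible for nonreal [w]
    ([nonreal_resolvent]).  If [G] is compact, so is [C]; by the
    Hilbert-Schmidt theorem ([hilbert_schmidt]) it has an orthonormal basis of
    eigenvectors, and [T^-1] maps it to a Riesz basis of eigenvectors of
    [L_K^*].

    The estimates are carried out in the real numbers, for the real part of
    the inner product and the real-valued norm: complex linearity recovers the
    complex inner product ([ip_eq]).  Limits of sequences come from one
    completeness statement for sequences with geometrically decreasing steps
    ([geometric_limit]), and limiting equalities are obtained by bounding a
    norm by every term of a geometric sequence ([le_geometric_le0]). *)

(** * The underlying real inner product space *)

Section RealStructure.
Set Implicit Arguments.
Unset Strict Implicit.
Variables (R : realType) (H : completeNormedModType R[i]).
Variable (ip : {dot H for Num.conj}).
Hypothesis ip_norm : forall x : H, `|x| ^+ 2 = ip x x.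
Implicit Types (x y z : H) (r s t : R).

Definition rip x y : R := complex.Re (ip x y).
Definition rnorm x : R := complex.Re `|x|.

Lemma ReD (z w : R[i]) : complex.Re (z + w) = complex.Re z + complex.Re w.
Proof. by case: z w => ? ? []. Qed.

Lemma Re_scale t (z : R[i]) : complex.Re (t%:C * z) = t * complex.Re z.
Proof. by case: z => a b /=; rewrite mul0r subr0. Qed.

Lemma ipC x y : ip x y = ((ip y x)^*)%C.
Proof. by rewrite hermC /= expr0 mul1r. Qed.

Lemma ripC x y : rip x y = rip y x.
Proof. by rewrite /rip ipC; case: (ip y x). Qed.

Lemma ripDl x y z : rip (x + y) z = rip x z + rip y z.
Proof. by rewrite /rip linearDl ReD. Qed.

Lemma ripDr x y z : rip z (x + y) = rip z x + rip z y.
Proof. by rewrite !(ripC z) ripDl. Qed.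

Lemma ripZl t x y : rip (t%:C *: x) y = t * rip x y.
Proof. by rewrite /rip linearZl_LR /= Re_scale. Qed.

Lemma ripZr t x y : rip x (t%:C *: y) = t * rip x y.
Proof. by rewrite ripC ripZl ripC. Qed.

Lemma ripNl x y : rip (- x) y = - rip x y.
Proof. by rewrite /rip linearNl /=; case: (ip x y). Qed.

Lemma ripNr x y : rip x (- y) = - rip x y.
Proof. by rewrite ripC ripNl ripC. Qed.

Lemma ripBl x y z : rip (x - y) z = rip x z - rip y z.
Proof. by rewrite ripDl ripNl. Qed.

Lemma ripBr x y z : rip z (x - y) = rip z x - rip z y.
Proof. by rewrite ripDr ripNr. Qed.

Lemma rip0l x : rip 0 x = 0.
Proof. by rewrite -(subrr 0) ripBl subrr. Qed.

Lemma rip0r x : rip x 0 = 0.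
Proof. by rewrite ripC rip0l. Qed.

Definition ripE := (ripDl, ripDr, ripNl, ripNr, ripZl, ripZr).

(** The imaginary part of [ip] is a value of [rip], so that no information is lost by
    passing to the real inner product. *)
Lemma rip_il x y : rip ('i *: x) y = - complex.Im (ip x y).
Proof. by rewrite /rip linearZl_LR /=; case: (ip x y) => a b /=; rewrite mul0r mul1r sub0r. Qed.

Lemma rip_ir x y : rip x ('i *: y) = complex.Im (ip x y).
Proof. by rewrite ripC rip_il ipC; case: (ip x y) => a b /=; rewrite opprK. Qed.

Lemma rip_iC x y : rip ('i *: x) y = - rip x ('i *: y).
Proof. by rewrite rip_il rip_ir. Qed.

Lemma rip_ii x y : rip ('i *: x) ('i *: y) = rip x y.
Proof.
by rewrite rip_iC /rip !linearZr_LR /=; case: (ip x y) => a b /=; ring.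
Qed.

Lemma ip_eq x y x' y' : rip x y = rip x' y' ->
  rip x ('i *: y) = rip x' ('i *: y') -> ip x y = ip x' y'.
Proof.
rewrite !rip_ir /rip => h1 h2; apply/eqP.
by rewrite eq_complex h1 h2 !eqxx.
Qed.

Lemma normE x : `|x| = (rnorm x)%:C.
Proof. by rewrite /rnorm RRe_real // ger0_real. Qed.

Lemma rnorm_ge0 x : 0 <= rnorm x.
Proof. by rewrite -ler0c -normE. Qed.

Lemma ripxx x : rip x x = rnorm x ^+ 2.
Proof. by rewrite /rip -ip_norm normE -rmorphXn. Qed.

Lemma rnorm_eq0 x : rnorm x = 0 -> x = 0.
Proof. by move=> h; apply/eqP; rewrite -normr_eq0 normE h. Qed.

Lemma rnorm0 : rnorm 0 = 0.
Proof. by rewrite /rnorm normr0. Qed.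

Lemma rnorm_le0 x : rnorm x <= 0 -> x = 0.
Proof. by move=> h; apply: rnorm_eq0; apply/eqP; rewrite eq_le h rnorm_ge0. Qed.

Lemma rnorm_gt0 x : x != 0 -> 0 < rnorm x.
Proof.
move=> xN0; rewrite lt_neqAle rnorm_ge0 andbT eq_sym.
by apply: contra xN0 => /eqP/rnorm_eq0 ->.
Qed.

Lemma rnormN x : rnorm (- x) = rnorm x.
Proof. by rewrite /rnorm normrN. Qed.

Lemma rnormB x y : rnorm (x - y) = rnorm (y - x).
Proof. by rewrite -rnormN opprB. Qed.

Lemma rnormD x y : rnorm (x + y) <= rnorm x + rnorm y.
Proof. by rewrite -lecR rmorphD /= -!normE ler_normD. Qed.

Lemma rnormZ t x : rnorm (t%:C *: x) = `|t| * rnorm x.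
Proof.
apply: complexI; rewrite -normE rmorphM /= -normE normrZ; congr (_ * _).
by rewrite normc_def /= expr0n /= addr0 sqrtr_sqr.
Qed.

Lemma rip_le x y : rip x y <= rnorm x * rnorm y.
Proof.
have [->|yN0] := eqVneq y 0; first by rewrite rip0r rnorm0 mulr0.
have [->|xN0] := eqVneq x 0; first by rewrite rip0l rnorm0 mul0r.
have hx := rnorm_gt0 xN0; have hy := rnorm_gt0 yN0.
have := sqr_ge0 (rnorm ((rnorm y)%:C *: x - (rnorm x)%:C *: y)).
rewrite -ripxx !ripE !ripxx (ripC y x) => h.
have {}h : 0 <= (rnorm x * rnorm y) * (rnorm x * rnorm y - rip x y) by nra.
by rewrite pmulr_rge0 ?mulr_gt0 // subr_ge0 in h.
Qed.

Lemma rip_abs x y : `|rip x y| <= rnorm x * rnorm y.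
Proof.
by rewrite ler_norml rip_le andbT lerNl -ripNl -(rnormN x) rip_le.
Qed.

Lemma rip_eq0 x : (forall y, rip x y = 0) -> x = 0.
Proof.
move=> h; apply: rnorm_eq0; have := h x; rewrite ripxx => /eqP.
by rewrite sqrf_eq0 => /eqP.
Qed.

Lemma rip_ext x y : (forall z, rip x z = rip y z) -> x = y.
Proof.
move=> h; apply/eqP; rewrite -subr_eq0; apply/eqP; apply: rip_eq0 => z.
by rewrite ripBl h subrr.
Qed.

Lemma rnorm_le_rip x r : 0 <= r ->
  (forall y, rip x y <= r * rnorm y) -> rnorm x <= r.
Proof.
move=> r0 h; have := h x; rewrite ripxx expr2.
have [->|xN0] := eqVneq x 0; first by rewrite rnorm0.
by rewrite ler_pM2r ?rnorm_gt0.
Qed.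

(** * Bounded and symmetric operators *)

Definition symmetric_op (f : H -> H) := forall x y, rip (f x) y = rip x (f y).

(** Complex linearity upgrades an adjointness relation from the real inner product to the
    complex one. *)
Lemma rip_adjoint_ip (f : {linear H -> H}) y z :
  (forall x, rip (f x) y = rip x z) -> forall x, ip (f x) y = ip x z.
Proof.
move=> fyz x; apply: ip_eq => //; apply: oppr_inj.
by rewrite -!rip_iC -fyz linearZ.
Qed.

Lemma symmetric_op_ip (f : {linear H -> H}) : symmetric_op f ->
  forall x y, ip (f x) y = ip x (f y).
Proof. by move=> fS x y; apply: rip_adjoint_ip => u; exact: fS. Qed.

Lemma bounded_continuous (f : {linear H -> H}) r :
  (forall x, rnorm (f x) <= r * rnorm x) -> continuous f.
Proof.
move=> fr; apply/linear_bounded_continuous/linear_boundedP.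
exists r%:C; split=> [|M rM x]; first by apply/complex_realP; exists r.
have := ler_wpM2r (normr_ge0 x) (ltW rM); apply: le_trans.
by rewrite !normE -rmorphM lecR.
Qed.

Lemma continuous_bounded (f : {linear H -> H}) : continuous f ->
  exists2 r, 0 < r & forall x, rnorm (f x) <= r * rnorm x.
Proof.
move=> /linear_bounded_continuous/linear_boundedP/pinfty_ex_gt0[M M0 hM].
have ME : M = (complex.Re M)%:C by rewrite RRe_real // gtr0_real.
exists (complex.Re M) => [|x]; first by rewrite -ltcR -ME.
by move: (hM x); rewrite !normE ME -rmorphM lecR.
Qed.

(** * Completeness and closure in terms of geometric estimates *)

Lemma geometric_small q r s : 0 <= q < 1 -> 0 < s ->
  exists n : nat, r * q ^+ n < s.
Proof.
move=> /andP[q0 q1] s0.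
have q1' : `|q| < 1 by rewrite ger0_norm.
have hs : 0 < s / (`|r| + 1) by rewrite divr_gt0 // ltr_wpDl.
have /cvgrPdist_lt/(_ _ hs)[N _ hN] := cvg_expr q1'.
exists N; have := hN N (leqnn N).
rewrite /= sub0r normrN ger0_norm ?exprn_ge0 // ltr_pdivlMr ?ltr_wpDl //.
apply: le_lt_trans; rewrite mulrC ler_wpM2l ?exprn_ge0 //.
by rewrite (le_trans (ler_norm r)) // lerDl.
Qed.

(** Turns an estimate valid along a geometrically convergent approximation into a statement
    on the limit. *)
Lemma le_geometric_le0 q r s : 0 <= q < 1 ->
  (forall n, s <= r * q ^+ n) -> s <= 0.
Proof.
move=> q01 h; rewrite leNgt; apply/negP => s0.
by have [n] := geometric_small r q01 s0; rewrite ltNge h.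
Qed.

Lemma ballE x (e : R[i]) y : 0 < e -> ball x e y <-> rnorm (x - y) < complex.Re e.
Proof.
move=> e0; rewrite -ball_normE /= normE -ltcR.
by rewrite (@RRe_real _ e) // gtr0_real.
Qed.

(** The only use of completeness; the explicit rate replaces further limit arguments. *)
Lemma geometric_limit (u : nat -> H) q r : 0 <= q < 1 ->
    (forall n, rnorm (u n.+1 - u n) <= r * q ^+ n) ->
  exists l, forall n, rnorm (l - u n) <= r / (1 - q) * q ^+ n.
Proof.
move=> /[dup] q01 /andP[q0 q1] hu.
have r0 : 0 <= r by have := hu 0; rewrite expr0 mulr1; apply: le_trans (rnorm_ge0 _).
have q1' : 0 < 1 - q by rewrite subr_gt0.
set c := r / (1 - q); have c0 : 0 <= c by rewrite divr_ge0 // ltW.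
have cE : r = c * (1 - q) by rewrite /c divfK // gt_eqF.
have hc n m : rnorm (u (n + m)%N - u n) <= c * q ^+ n.
  have : rnorm (u (n + m)%N - u n) <= c * q ^+ n - c * q ^+ (n + m).
    elim: m => [|m IH]; first by rewrite addn0 !subrr rnorm0.
    rewrite addnS -(subrK (u (n + m)%N) (u (n + m).+1)) -addrA.
    apply: le_trans (rnormD _ _) _; apply: le_trans (lerD (hu _) IH) _.
    by rewrite cE exprS le_eqVlt; apply/orP; left; apply/eqP; ring.
  by move=> h; apply: (le_trans h); rewrite gerBl mulr_ge0 ?exprn_ge0.
have : cvg (u @ \oo).
  apply/cauchy_cvgP; apply: cauchy_exP => e e0.
  have eE : e = (complex.Re e)%:C by rewrite RRe_real // gtr0_real.
  have e0' : 0 < complex.Re e by rewrite -ltcR -eE.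
  have [n hn] := geometric_small c q01 e0'.
  exists (u n), n => // m /= nm; apply/(ballE _ _ e0).
  by rewrite rnormB -(subnKC nm); apply: le_lt_trans (hc _ _) hn.
move=> /cvg_ex[l ul]; exists l => n.
rewrite leNgt; apply/negP; rewrite -subr_gt0 => d0.
have d0' : 0 < (rnorm (l - u n) - c * q ^+ n)%:C :> R[i] by rewrite ltcR.
have /cvgrPdist_lt/(_ _ d0')[N _ hN] := ul.
have := hN (n + N)%N (leq_addl _ _); rewrite /= normE ltcR.
have := hc n N; have := rnormD (l - u (n + N)%N) (u (n + N)%N - u n).
by rewrite addrA subrK; lra.
Qed.

Lemma closure_rnormP (D : set H) x :
  closure D x <-> forall e, 0 < e -> exists2 y, D y & rnorm (x - y) < e.
Proof.
split=> [cD e e0|h B /nbhs_ballP[e /= e0 eB]].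
  have e0' : 0 < e%:C :> R[i] by rewrite ltcR.
  have [y [Dy /(ballE _ _ e0') ye]] := cD _ (nbhsx_ballx x _ e0').
  by exists y.
have e0' : 0 < complex.Re e by rewrite -ltcR RRe_real // gtr0_real.
have [y Dy xy] := h _ e0'; exists y; split => //.
by apply: eB; apply/(ballE _ _ e0).
Qed.

Lemma dense_rnormP (D : set H) : dense D ->
  forall x e, 0 < e -> exists2 y, D y & rnorm (x - y) < e.
Proof.
move=> dD x; apply/closure_rnormP => B /nbhs_interior.
rewrite nbhsE => -[U [Uo Ux] UB].
have [|y [Uy Dy]] := dD U _ Uo; first by exists x.
by exists y; split => //; apply: interior_subset; exact: UB.
Qed.

(** * Minimization, adjoints and uniform boundedness *)

(** Both the Riesz representation theorem ([D] the whole space) and the orthogonal projection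
    onto the closure of [D] ([phi] an inner product with a fixed vector): by the parallelogram
    identity, a minimizing sequence of [|x|^2 - 2 phi x] on [D] converges, and its limit [a]
    satisfies the Euler equation. *)
Lemma quadratic_minimizer (D : set H) (phi : H -> R) r :
    D 0 -> (forall x y, D x -> D y -> D (x + y)) ->
    (forall t x, D x -> D (t%:C *: x)) ->
    {morph phi : x y / x + y} -> (forall t x, phi (t%:C *: x) = t * phi x) ->
    (forall x, phi x <= r * rnorm x) ->
  exists2 a, closure D a & forall h, D h -> rip h a = phi h.
Proof.
move=> D0 DD DZ phiD phiZ phi_le.
pose J x := rip x x - 2 * phi x.
have hasinf : has_inf (J @` D).
  split; first by exists (J 0), 0.
  exists (- r ^+ 2) => _ [x _ <-]; rewrite /J ripxx.
  have := phi_le x; have := sqr_ge0 (rnorm x - r); nra.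
set m := inf (J @` D).
have Jm x : D x -> m <= J x by move=> Dx; apply: ge_inf; [exact: hasinf.2 | exists x].
pose q : R := 2^-1; have q01 : 0 <= q < 1 by rewrite /q; apply/andP; split; lra.
have [q0 q1] := andP q01.
have Je n : exists x, D x /\ J x < m + (q ^+ n) ^+ 2.
  have q2 : 0 < (q ^+ n) ^+ 2 by rewrite !exprn_gt0 // /q.
  by have [_ [x Dx <-] Jx] := inf_adherent q2 hasinf; exists x.
have {Je}[u uP] := choice Je.
have qS n : q ^+ n.+1 = q ^+ n / 2 by rewrite exprSr.
have udist n : rnorm (u n.+1 - u n) <= 2 * q ^+ n.
  have [[Da Ja] [Db Jb]] := (uP n, uP n.+1).
  have Jc := Jm _ (DZ 2^-1 _ (DD _ _ Da Db)).
  have qn : 0 <= q ^+ n by rewrite exprn_ge0.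
  rewrite -(@ler_pXn2r _ 2) ?nnegrE ?rnorm_ge0 ?mulr_ge0 // -ripxx.
  move: Ja Jb Jc; rewrite /J !phiZ !phiD !ripE (ripC (u n) (u n.+1)) qS.
  by nra.
have [a ha] := geometric_limit q01 udist; exists a.
  apply/closure_rnormP => e e0.
  have [n hn] := geometric_small (2 / (1 - q)) q01 e0.
  by exists (u n); [have [] := uP n | exact: le_lt_trans (ha n) hn].
move=> h Dh; apply/eqP; rewrite -subr_eq0 -normr_le0.
apply: (@le_geometric_le0 q (4 * rnorm h + (rnorm h ^+ 2 + 1))) => // n.
have [Dn Jn] := uP n.
have qn : 0 < q ^+ n by rewrite exprn_gt0 // /q.
(* compare J at u n with its values at u n + t h and u n - t h, where t = q ^+ n *)
have J1 := Jm _ (DD _ _ Dn (DZ (q ^+ n) _ Dh)).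
have J2 := Jm _ (DD _ _ Dn (DZ (- q ^+ n) _ Dh)).
move: J1 J2 Jn; rewrite /J !phiD !phiZ !ripE (ripC (u n) h) !ripxx => J1 J2 Jn.
set d := rip h (u n) - phi h.
have d1 : 0 <= q ^+ n * (q ^+ n * (rnorm h ^+ 2 + 1) + 2 * d) by rewrite /d; nra.
have d2 : 0 <= q ^+ n * (q ^+ n * (rnorm h ^+ 2 + 1) - 2 * d) by rewrite /d; nra.
rewrite pmulr_rge0 // in d1; rewrite pmulr_rge0 // in d2.
have -> : rip h a - phi h = rip h (a - u n) + d by rewrite ripBr /d; ring.
apply: (le_trans (ler_normD _ _)); rewrite mulrDl; apply: lerD.
  apply: (le_trans (rip_abs _ _)); rewrite mulrAC mulrC ler_wpM2r ?rnorm_ge0 //.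
  have qE : 1 - q = 2^-1 by rewrite /q; lra.
  have -> : 4 = 2 / (1 - q) by rewrite qE invrK; lra.
  exact: ha.
by rewrite ler_norml; apply/andP; split; nra.
Qed.

(** Operators obtained by choice are first bare functions; this packs them once linearity is known. *)
Lemma linear_bundle (f : H -> H) : linear f -> exists g : {linear H -> H}, g = f :> (H -> H).
Proof.
by move=> lf; exists (HB.pack f (GRing.isLinear.Build _ _ _ _ _ lf) : {linear H -> H}).
Qed.

Lemma ip_ext x y : (forall z, ip z x = ip z y) -> x = y.
Proof. by move=> h; apply: rip_ext => z; rewrite !(ripC _ z) /rip h. Qed.

(** Complex linearity of an adjoint is automatic, since it is determined by its inner products. *)
Lemma adjoint_linear (f : {linear H -> H}) (g : H -> H) :
  (forall x y, rip (f x) y = rip x (g y)) -> linear g.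
Proof.
move=> fg.
have fgC x y : ip (f x) y = ip x (g y) by apply: rip_adjoint_ip => u; exact: fg.
move=> a x y; apply: ip_ext => z.
by rewrite -fgC linearDr linearZr_LR linearDr linearZr_LR /= -!fgC.
Qed.

Lemma adjoint_exists (f : {linear H -> H}) : continuous f ->
  exists g : {linear H -> H}, continuous g /\ forall x y, rip (f x) y = rip x (g y).
Proof.
move=> /continuous_bounded[r r0 fr].
have fg y : exists z, forall x, rip (f x) y = rip x z.
  have [| | | | | |z _ hz] := @quadratic_minimizer setT (fun x => rip (f x) y) (r * rnorm y) => //.
  - by move=> x x' /=; rewrite linearD ripDl.
  - by move=> t x /=; rewrite linearZ ripZl.
  - move=> x; apply: (le_trans (rip_le _ _)).
    by rewrite mulrAC ler_wpM2r ?rnorm_ge0.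
  by exists z => x; rewrite hz.
have {fg}[g0 fg] := choice fg.
have fg' x y := fg y x.
have [g gE] := linear_bundle (adjoint_linear fg').
exists g; rewrite gE; split => //.
suff : forall y, rnorm (g y) <= r * rnorm y by move=> /bounded_continuous; rewrite gE.
move=> y; apply: rnorm_le_rip => [|x]; first by rewrite mulr_ge0 ?rnorm_ge0 // ltW.
rewrite gE ripC -fg'; apply: (le_trans (rip_le _ _)).
by rewrite mulrAC ler_wpM2r ?rnorm_ge0.
Qed.

(** The uniform boundedness principle, by a gliding hump.  If it fails there are [g n] in [G]
    whose norm grows faster than [n 3^n]; moving by [3^-n] in the direction of [g n] or of
    [- g n] makes the inner product with [g n] at least [3^-n |g n|], and the later moves, of
    total length at most [3^-n / 2], undo at most half of it. *)
Lemma weakly_bounded (G : set H) :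
  (forall y, exists r, forall g, G g -> `|rip g y| <= r) ->
  exists r, forall g, G g -> rnorm g <= r.
Proof.
move=> wb; apply: contrapT => ub.
pose q : R := 3^-1; have q01 : 0 <= q < 1 by rewrite /q; apply/andP; split; lra.
have [q0 q1] := andP q01.
have qn n : 0 < q ^+ n by rewrite exprn_gt0 // /q.
have hg (n : nat) : exists g, G g /\ n%:R * 2 < q ^+ n * rnorm g.
  apply: contrapT => ng; apply: ub; exists (n%:R * 2 / q ^+ n) => g Gg.
  rewrite ler_pdivlMr // leNgt; apply/negP; rewrite [rnorm g * _]mulrC => hn.
  by apply: ng; exists g.
have {hg}[g gP] := choice hg.
(* one of x + e and x - e has a large inner product with g n, by the sign of that of x *)
have hstep (nx : nat * H) : exists z,
    rnorm (z - nx.2) <= q ^+ nx.1 /\ q ^+ nx.1 * rnorm (g nx.1) <= `|rip (g nx.1) z|.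
  case: nx => n x /=.
  have g0 : 0 < rnorm (g n).
    have [_] := gP n; rewrite -(pmulr_rgt0 _ (qn n)); apply: le_lt_trans.
    by rewrite mulr_ge0.
  set e := (q ^+ n / rnorm (g n))%:C *: g n.
  have ee : rnorm e = q ^+ n.
    by rewrite rnormZ ger0_norm ?divr_ge0 ?(ltW g0) ?(ltW (qn n)) // divfK // gt_eqF.
  have ge : rip (g n) e = q ^+ n * rnorm (g n).
    by rewrite ripZr ripxx expr2 mulrA divfK // gt_eqF.
  case: (leP 0 (rip (g n) x)) => gx.
    exists (x + e); rewrite addrC addKr ee; split => //.
    by rewrite ripDr ge (le_trans _ (ler_norm _)) // lerDr.
  exists (x - e); rewrite addrC addKr rnormN ee; split => //.
  by rewrite ripBr ge -normrN (le_trans _ (ler_norm _)) // opprB lerBrDl addrC gerDl ltW.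
have {hstep}[step stepP] := choice hstep.
pose u := nat_rect (fun=> H) 0 (fun n x => step (n, x)).
have udist n : rnorm (u n.+1 - u n) <= 1 * q ^+ n.
  by rewrite mul1r; exact: (stepP (n, u n)).1.
have [l hl] := geometric_limit q01 udist.
have [r hr] := wb l.
have [n rn] : exists n : nat, r < n%:R by exists (Num.truncn r).+1; exact: truncnS_gt.
have [Gg gn] := gP n.
have g1 := (stepP (n, u n)).2; rewrite /= -/(u n.+1) in g1.
have cE : 1 / (1 - q) = 3 / 2.
  have -> : 1 - q = 2 / 3 by rewrite /q; lra.
  by field.
have h1 : rnorm (u n.+1 - l) <= q ^+ n / 2.
  have := hl n.+1; rewrite rnormB cE exprSr => /le_trans; apply.
  by rewrite le_eqVlt; apply/orP; left; apply/eqP; rewrite /q; field.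
have h2 := ler_wpM2l (rnorm_ge0 (g n)) h1.
have h3 := rip_abs (g n) (u n.+1 - l).
have h4 := ler_normD (rip (g n) (u n.+1 - l)) (rip (g n) l).
rewrite -ripDr subrK in h4.
have := hr _ Gg; nra.
Qed.

(** * Inverses and square roots of positive operators *)

Lemma bounded_inverse (f : {linear H -> H}) r : 0 < r ->
    (forall x, r * rnorm x <= rnorm (f x)) -> (forall y, exists x, f x = y) ->
  exists g : {linear H -> H}, [/\ continuous g, cancel f g & cancel g f].
Proof.
move=> r0 fr /choice[g0 fK].
have finj x y : f x = f y -> x = y.
  move=> fxy; apply/eqP; rewrite -subr_eq0; apply/eqP/rnorm_le0.
  by rewrite -(pmulr_rle0 _ r0); apply: le_trans (fr _) _; rewrite linearB fxy subrr rnorm0.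
have lg : linear g0 by move=> a x y; apply: finj; rewrite linearP !fK.
have [g gE] := linear_bundle lg.
exists g; split; last 2 first.
- by move=> x; apply: finj; rewrite gE fK.
- by move=> x; rewrite gE fK.
apply: (@bounded_continuous _ r^-1) => x; rewrite gE.
by rewrite ler_pdivlMl // -[in leRHS](fK x).
Qed.

(** Fixed points of the contraction [x |-> f x + y]. *)
Lemma neumann (f : {linear H -> H}) q : 0 <= q < 1 ->
  (forall x, rnorm (f x) <= q * rnorm x) -> forall y, exists x, x - f x = y.
Proof.
move=> q01 fq y; have [q0 q1] := andP q01.
pose u := nat_rect (fun=> H) 0 (fun _ x => f x + y).
have udist n : rnorm (u n.+1 - u n) <= rnorm y * q ^+ n.
  elim: n => [|n IH]; first by rewrite /= linear0 add0r subr0 mulr1.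
  rewrite [u n.+2]/= [u n.+1 in X in _ - X]/= opprD addrACA subrr addr0 -linearB.
  by apply: (le_trans (fq _)); rewrite exprSr mulrA mulrC ler_wpM2r.
have [l hl] := geometric_limit q01 udist; exists l.
apply/eqP; rewrite -subr_eq0; apply/eqP/rnorm_le0.
set c := rnorm y / (1 - q) in hl.
apply: (@le_geometric_le0 q (2 * c)) => // n.
have -> : l - f l - y = (l - u n.+1) - f (l - u n).
  rewrite linearB /= opprB opprD !addrA (addrAC (l - f (u n))) subrK.
  exact: addrAC.
apply: (le_trans (rnormD _ _)); rewrite rnormN.
have := fq (l - u n); have := hl n; have := hl n.+1; rewrite exprS.
have := rnorm_ge0 (l - u n); nra.
Qed.

Lemma rnormZC (a : R[i]) x : rnorm (a *: x) = complex.Re `|a| * rnorm x.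
Proof. by rewrite /rnorm normrZ normE; case: (`|a|) => u v /=; rewrite mulr0 subr0. Qed.

(** For small [t], [|x - t P x|^2 <= (1 - 2 t r + t^2 |P|^2) |x|^2]; with [m >= |P|] the choice
    [t = r / m^2] minimizes the bound, which becomes [1 - (r / m)^2]. *)
Lemma coercive_contraction (P : {linear H -> H}) r : 0 < r ->
    (forall x, r * rnorm x ^+ 2 <= rip (P x) x) -> continuous P ->
  exists t q, [/\ 0 < t, 0 <= q < 1 & forall x, rnorm (x - t%:C *: P x) <= q * rnorm x].
Proof.
move=> r0 Pr /continuous_bounded[s s0 Ps].
(* s + r instead of s, so that r <= m also on the zero space *)
pose m := s + r; have m0 : 0 < m by rewrite addr_gt0.
have rm : r / m <= 1 by rewrite ler_pdivrMr // mul1r /m lerDr ltW.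
have rm0 : 0 < r / m by rewrite divr_gt0.
have w0 : 0 <= 1 - (r / m) ^+ 2 by nra.
have sw := sqr_sqrtr w0; have sw0 := sqrtr_ge0 (1 - (r / m) ^+ 2).
exists (r / m ^+ 2), (Num.sqrt (1 - (r / m) ^+ 2)); split.
- by rewrite divr_gt0 // exprn_gt0.
- by apply/andP; split => //; nra.
move=> x; rewrite -(@ler_pXn2r _ 2) ?nnegrE ?rnorm_ge0 ?mulr_ge0 ?rnorm_ge0 //.
rewrite exprMn sw -ripxx !ripE !ripxx (ripC x).
set t := r / m ^+ 2.
have t0 : 0 < t by rewrite divr_gt0 // exprn_gt0.
have tE : (r / m) ^+ 2 = 2 * t * r - t ^+ 2 * m ^+ 2.
  by rewrite /t; field; rewrite gt_eqF.
have Pm : rnorm (P x) ^+ 2 <= m ^+ 2 * rnorm x ^+ 2.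
  rewrite -exprMn ler_pXn2r ?nnegrE ?rnorm_ge0 ?mulr_ge0 ?rnorm_ge0 ?(ltW m0) //.
  by apply: le_trans (Ps x) _; rewrite ler_wpM2r ?rnorm_ge0 // /m lerDl ltW.
have h1 := ler_wpM2l (ltW t0) (Pr x).
have h2 := ler_wpM2l (sqr_ge0 t) Pm.
rewrite tE; nra.
Qed.

(** The equation for [Y] says that [(I - Y)^2 = I - Q].  The iteration
    [Z (n+1) = (Q + (Z n)^2) / 2] from [Z 0 = 0] stays in the ball of radius [q], where
    [Z |-> Z^2 / 2] contracts with factor [q]; it converges pointwise at a geometric rate, and
    linearity, symmetry and the equation pass to the limit. *)
Lemma sqrt_iteration (Q : {linear H -> H}) q : 0 <= q < 1 ->
    (forall x, rnorm (Q x) <= q * rnorm x) -> symmetric_op Q ->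
  exists Y : {linear H -> H}, [/\ forall x, rnorm (Y x) <= q * rnorm x,
    symmetric_op Y & forall x, Q x + Y (Y x) = Y x + Y x].
Proof.
move=> q01 Qq Qsym; have [q0 q1] := andP q01.
pose step (Y : {linear H -> H}) : {linear H -> H} := (2^-1%:C) \*: (Q \+ (Y \o Y)).
pose Z := nat_rect (fun=> {linear H -> H}) (\0 : {linear H -> H}) (fun _ => step).
have ZS n x : Z n.+1 x = 2^-1%:C *: (Q x + Z n (Z n x)) by [].
have Z0 x : Z 0%N x = 0 by [].
have h2 : `|2^-1 : R| = 2^-1 by rewrite ger0_norm // invr_ge0.
have Zq n x : rnorm (Z n x) <= q * rnorm x.
  elim: n x => [|n IH] x; first by rewrite rnorm0 mulr_ge0 ?rnorm_ge0.
  rewrite ZS rnormZ h2.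
  have := rnormD (Q x) (Z n (Z n x)); have := IH (Z n x); have := IH x; have := Qq x.
  by have := rnorm_ge0 x; have := rnorm_ge0 (Z n x); nra.
have Zsym n : symmetric_op (Z n).
  elim: n => [|n IH] x y; first by rewrite rip0l rip0r.
  by rewrite !ZS !ripE Qsym !IH.
have Zd n x : rnorm (Z n.+1 x - Z n x) <= rnorm x * q ^+ n.
  elim: n x => [|n IH] x.
    rewrite ZS !Z0 addr0 subr0 rnormZ h2 mulr1.
    by have := Qq x; have := rnorm_ge0 x; nra.
  have -> : Z n.+2 x - Z n.+1 x
      = 2^-1%:C *: (Z n.+1 (Z n.+1 x - Z n x) + (Z n.+1 (Z n x) - Z n (Z n x))).
    by rewrite linearB addrA subrK (ZS n.+1) (ZS n x) -scalerBr opprD addrACA subrr add0r.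
  rewrite rnormZ h2 exprS.
  have := rnormD (Z n.+1 (Z n.+1 x - Z n x)) (Z n.+1 (Z n x) - Z n (Z n x)).
  have := Zq n.+1 (Z n.+1 x - Z n x); have := IH (Z n x).
  have qn : 0 <= q ^+ n by rewrite exprn_ge0.
  have a1 := ler_wpM2l q0 (IH x); have a2 := ler_wpM2r qn (Zq n x).
  by nra.
have /choice[Y0 hY] : forall x, exists l, forall n, rnorm (l - Z n x) <= rnorm x / (1 - q) * q ^+ n.
  by move=> x; exact: geometric_limit.
pose k x := rnorm x / (1 - q); have {}hY x n : rnorm (Y0 x - Z n x) <= k x * q ^+ n by exact: hY.
have Ylin : linear Y0.
  move=> a x y; apply/eqP; rewrite -subr_eq0; apply/eqP/rnorm_le0.
  apply: (@le_geometric_le0 q (k (a *: x + y) + complex.Re `|a| * k x + k y)) => // n.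
  have -> : Y0 (a *: x + y) - (a *: Y0 x + Y0 y) =
     (Y0 (a *: x + y) - Z n (a *: x + y)) - (a *: (Y0 x - Z n x) + (Y0 y - Z n y)).
    by rewrite linearP scalerBr addrACA -opprD opprB addrA subrK.
  apply: le_trans (rnormD _ _) _; rewrite rnormN -addrA mulrDl lerD //.
  apply: le_trans (rnormD _ _) _; rewrite mulrDl lerD // rnormZC -mulrA ler_wpM2l //.
  by rewrite -ler0c RRe_real.
have [Y YE] := linear_bundle Ylin; rewrite -YE in hY.
have Yq x : rnorm (Y x) <= q * rnorm x.
  rewrite -subr_le0; apply: (@le_geometric_le0 q (k x)) => // n.
  have := rnormD (Y x - Z n x) (Z n x); rewrite subrK.
  by have := hY x n; have := Zq n x; lra.
exists Y; split => // [x y|x].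
  apply/eqP; rewrite -subr_eq0 -normr_le0.
  apply: (@le_geometric_le0 q (k x * rnorm y + rnorm x * k y)) => // n.
  have -> : rip (Y x) y - rip x (Y y) = rip (Y x - Z n x) y - rip x (Y y - Z n y).
    by rewrite ripBl ripBr Zsym; ring.
  apply: le_trans (ler_normB _ _) _; rewrite mulrDl; apply: lerD.
    by apply: le_trans (rip_abs _ _) _; rewrite mulrAC ler_wpM2r ?rnorm_ge0.
  by apply: le_trans (rip_abs _ _) _; rewrite -mulrA ler_wpM2l ?rnorm_ge0.
apply/eqP; rewrite -subr_eq0; apply/eqP/rnorm_le0.
apply: (@le_geometric_le0 q (k (Y x) + q * k x + 2 * (k x * q))) => // n.
have -> : Q x + Y (Y x) - (Y x + Y x) =
    (Y (Y x) - Z n (Y x)) + Z n (Y x - Z n x) - 2%:C *: (Y x - Z n.+1 x).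
  by rewrite linearB ZS; apply: rip_ext => z; rewrite !ripE; lra.
apply: le_trans (rnormD _ _) _; rewrite rnormN rnormZ.
have := rnormD (Y (Y x) - Z n (Y x)) (Z n (Y x - Z n x)).
have := hY (Y x) n; have := hY x n.+1; have := Zq n (Y x - Z n x).
have := ler_wpM2l q0 (hY x n); rewrite exprS (ger0_norm (ler0n R 2)); nra.
Qed.

(** Coercivity lets one scale [P] so that [I - t P] is a strict contraction [Q]; then
    [T = t^(-1/2) (I - Y)] with [(I - Y)^2 = I - Q], and [I - Y] is invertible by [neumann]. *)
Lemma positive_sqrt (P : {linear H -> H}) r : 0 < r ->
    (forall x, r * rnorm x ^+ 2 <= rip (P x) x) -> continuous P -> symmetric_op P ->
  exists T T' : {linear H -> H}, [/\ continuous T /\ continuous T', cancel T T',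
    cancel T' T, symmetric_op T & forall x, T (T x) = P x].
Proof.
move=> r0 Pr Pc Psym; have [t [q [t0 q01 tq]]] := coercive_contraction r0 Pr Pc.
have [q0 q1] := andP q01.
pose Q : {linear H -> H} := idfun \- (t%:C \*: P).
have Qsym : symmetric_op Q by move=> x y; rewrite /= !ripE Psym.
have [Y [Yq Ysym YE]] := @sqrt_iteration Q q q01 tq Qsym.
pose s := Num.sqrt t^-1; have s0 : 0 < s by rewrite sqrtr_gt0 invr_gt0.
have sE : s * s = t^-1 by rewrite -expr2 sqr_sqrtr // invr_ge0 ltW.
pose T : {linear H -> H} := s%:C \*: (idfun \- Y).
have TE x : T x = s%:C *: (x - Y x) by [].
have Tn x : rnorm (T x) = s * rnorm (x - Y x) by rewrite TE rnormZ gtr0_norm.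
have sq0 : 0 < s * (1 - q) by rewrite mulr_gt0 // subr_gt0.
have [|y|T' [T'c TK T'K]] := @bounded_inverse T _ sq0.
- move=> x; rewrite Tn -mulrA ler_pM2l //.
  by have := rnormD (x - Y x) (Y x); rewrite subrK; have := Yq x; lra.
- have [x xE] := neumann q01 Yq (s^-1%:C *: y); exists x.
  by rewrite TE xE scalerA -rmorphM mulfV ?gt_eqF // scale1r.
exists T, T'; split => //.
- split => //; apply: (@bounded_continuous _ (s * (1 + q))) => x.
  rewrite Tn -mulrA ler_pM2l //; have := rnormD x (- Y x).
  by rewrite rnormN; have := Yq x; lra.
- by move=> x y; rewrite !TE !ripE Ysym.
move=> x; rewrite !TE linearZ /= -scalerBr scalerA -rmorphM sE.
have -> : x - Y x - Y (x - Y x) = t%:C *: P x.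
  rewrite linearB; apply: rip_ext => z.
  by have := congr1 (rip^~ z) (YE x); rewrite /= !ripE; lra.
by rewrite scalerA -rmorphM mulVf ?gt_eqF // scale1r.
Qed.

(** The hypothesis says that [(P x, x)] is real for all [x].  Polarization then gives
    symmetry; this uses the complex scalars. *)
Lemma symmetric_op_of_real (P : {linear H -> H}) :
  (forall x, rip (P x) ('i *: x) = 0) -> symmetric_op P.
Proof.
move=> P0 x y.
have polar u v : rip (P u) ('i *: v) = rip (P ('i *: v)) u.
  have := P0 (u + v); rewrite linearD scalerDr !ripE !P0 addr0 add0r.
  rewrite linearZ /= => /eqP; rewrite addr_eq0 => /eqP ->.
  by rewrite rip_iC.
have := polar x (- 'i *: y); rewrite scalerA mulrN -expr2 sqr_i opprK scale1r => ->.
by rewrite ripC.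
Qed.

(** [|P x|^2 <= m (P x, x)] whenever [P >= 0] has norm at most [m]: the form of [P] is
    nonnegative at [x - m^-1 P x].  Bounded invertibility then bounds [|x|^2] by [|P x|^2]. *)
Lemma nonneg_invertible_coercive (P : {linear H -> H}) s : 0 < s ->
    (forall x, rnorm x <= s * rnorm (P x)) -> continuous P ->
    symmetric_op P -> (forall x, 0 <= rip (P x) x) ->
  exists2 r, 0 < r & forall x, r * rnorm x ^+ 2 <= rip (P x) x.
Proof.
move=> s0 Ps /continuous_bounded[m m0 Pm] Psym P0.
have r0 : 0 < (m * s ^+ 2)^-1 by rewrite invr_gt0 mulr_gt0 // exprn_gt0.
exists (m * s ^+ 2)^-1 => // x.
rewrite ler_pdivrMl ?mulr_gt0 ?exprn_gt0 //.
have h1 : rnorm x ^+ 2 <= s ^+ 2 * rnorm (P x) ^+ 2.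
  by rewrite -exprMn ler_pXn2r ?nnegrE ?mulr_ge0 ?rnorm_ge0 // ltW.
have h2 := P0 (x - m^-1%:C *: P x).
have h3 : rnorm (P x) ^+ 2 <= m * rip (P x) x.
  have h4 : rip (P (P x)) (P x) <= m * rnorm (P x) ^+ 2.
    apply: le_trans (rip_le _ _) _; rewrite expr2 mulrA ler_wpM2r ?rnorm_ge0 //.
  move: h2; rewrite linearB linearZ /= !ripE (Psym (P x) x) !ripxx => h2.
  have mi : 0 < m^-1 by rewrite invr_gt0.
  have {}h4 := ler_wpM2l (ltW mi) (ler_wpM2l (ltW mi) h4).
  rewrite (mulrA m^-1 m) mulVf ?gt_eqF // mul1r in h4.
  have h5 : m^-1 * rnorm (P x) ^+ 2 <= rip (P x) x by lra.
  by rewrite ler_pdivrMl in h5.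
have := ler_wpM2l (sqr_ge0 s) h3; nra.
Qed.

(** * Nonreal resolvent points of a bounded symmetric operator *)

Lemma scaleCE (a : R[i]) x :
  a *: x = (complex.Re a)%:C *: x + (complex.Im a)%:C *: ('i *: x).
Proof. by rewrite scalerA -scalerDl [in LHS](complexE a) [_%:C * 'i]mulrC. Qed.

(** For [w = a + i b] and [A = C - a], the product of [A - i b] and [A + i b],
    [A^2 + b^2], is coercive, hence onto; and [|(A - i b) x|^2 = |A x|^2 + b^2 |x|^2]
    since [A] is symmetric. *)
Lemma nonreal_resolvent (C : {linear H -> H}) (w : R[i]) :
    continuous C -> symmetric_op C -> complex.Im w != 0 ->
  exists g : {linear H -> H}, [/\ continuous g,
    cancel (fun x => C x - w *: x) g & cancel g (fun x => C x - w *: x)].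
Proof.
move=> Cc Csym w0; set a := complex.Re w; set b := complex.Im w in w0.
have b20 : 0 < b ^+ 2 by rewrite exprn_even_gt0.
have [A AE] : exists A : {linear H -> H}, forall x, A x = C x - a%:C *: x.
  by exists (C \- (a%:C \*: idfun)).
have Asym : symmetric_op A by move=> x y; rewrite !AE !ripE Csym.
have [m m0 Cm] := continuous_bounded Cc.
have Am x : rnorm (A x) <= (m + `|a|) * rnorm x.
  rewrite AE mulrDl -rnormZ; apply: le_trans (rnormD _ _) _.
  by rewrite rnormN lerD2r.
have [P PE] : exists P : {linear H -> H}, forall x, P x = A (A x) + (b ^+ 2)%:C *: x.
  by exists ((A \o A) \+ ((b ^+ 2)%:C \*: idfun)).
have Pr x : b ^+ 2 * rnorm x ^+ 2 <= rip (P x) x.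
  by rewrite PE !ripE Asym !ripxx lerDr sqr_ge0.
have Pc : continuous P.
  apply: (@bounded_continuous _ ((m + `|a|) * (m + `|a|) + b ^+ 2)) => x.
  rewrite PE mulrDl; apply: le_trans (rnormD _ _) _.
  rewrite rnormZ (gtr0_norm b20) lerD2r -mulrA; apply: le_trans (Am _) _.
  by rewrite ler_wpM2l ?Am // addr_ge0 // ltW.
have Psym : symmetric_op P by move=> x y; rewrite !PE !ripE !Asym.
have [T [T' [_ _ T'K _ TT]]] := positive_sqrt b20 Pr Pc Psym.
have [N NC] : exists N : {linear H -> H}, forall x, N x = C x - w *: x.
  by exists (C \- (w \*: idfun)).
have NE x : N x = A x - b%:C *: ('i *: x).
  by rewrite NC AE (scaleCE w) opprD addrA.
have b0 : 0 < `|b| by rewrite normr_gt0.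
have cross x : rip (A x) ('i *: x) = 0.
  have : rip (A x) ('i *: x) = - rip (A x) ('i *: x).
    by rewrite {1}Asym linearZ /= ripC rip_iC.
  by lra.
have [|y|g gP] := @bounded_inverse N _ b0; last 1 first.
  case: gP => gc NK gK; exists g; split => // x.
    by rewrite -NC NK.
  by rewrite -NC gK.
- move=> x; rewrite -(@ler_pXn2r _ 2) ?nnegrE ?mulr_ge0 ?rnorm_ge0 //.
  rewrite exprMn real_normK ?num_real // -(ripxx (N x)) NE !ripE rip_ii !ripxx.
  rewrite (ripC _ (A x)) cross.
  by have := sqr_ge0 (rnorm (A x)); nra.
set u := T' (T' y).
have uE : A (A u) + (b ^+ 2)%:C *: u = y by rewrite -PE -TT !T'K.
(* u solves (A^2 + b^2) u = y, and A^2 + b^2 = (A - i b)(A + i b) *)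
exists (A u + b%:C *: ('i *: u)); rewrite NE -{}uE.
have -> : A (A u + b%:C *: ('i *: u)) = A (A u) + b%:C *: ('i *: A u).
  by rewrite [LHS]linearD [A (b%:C *: _)]linearZ [A ('i *: u)]linearZ.
have -> : 'i *: (A u + b%:C *: ('i *: u)) = 'i *: A u - b%:C *: u.
  by rewrite scalerDr scalerA mulrC -scalerA ['i *: ('i *: u)]scalerA -expr2 sqr_i scaleN1r scalerN.
by apply: rip_ext => z; rewrite !ripE; lra.
Qed.

(** * Compact symmetric operators *)

(** Compactness through cluster points of sequences, which needs no subsequences. *)
Definition seq_compact_op (C : H -> H) := forall u : nat -> H,
  (forall n, rnorm (u n) <= 1) ->
  exists y, forall (m : nat) e, 0 < e -> exists2 n, (m <= n)%N & rnorm (C (u n) - y) < e.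

(** Let [c] be the supremum of [|C x|^2] over the unit ball of [D].  Along a maximizing
    sequence [u n], symmetry gives [|C^2 u - c u|^2 <= c (c - |C u|^2)], which tends to [0]; so
    a cluster point [y] of [C (u n)] satisfies [C^2 y = c y], and it is nonzero because [c > 0]. *)
Lemma compact_eigenvector (C : {linear H -> H}) (D : set H) :
    continuous C -> symmetric_op C -> seq_compact_op C ->
    (forall x y, D x -> D y -> D (x + y)) -> (forall t x, D x -> D (t%:C *: x)) ->
    closure D `<=` D -> (forall x, D x -> D (C x)) ->
    (exists2 x, D x & C x != 0) ->
  exists e t, [/\ D e, rnorm e = 1 & C e = t%:C *: e].
Proof.
move=> /continuous_bounded[r r0 Cr] Csym Ccpt DD DZ Dcl DC [x0 Dx0 Cx0].
have normal x : D x -> x != 0 -> D ((rnorm x)^-1%:C *: x) /\ rnorm ((rnorm x)^-1%:C *: x) = 1.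
  move=> Dx xN0; split; first exact: DZ.
  have x1 := rnorm_gt0 xN0.
  by rewrite rnormZ ger0_norm ?invr_ge0 ?rnorm_ge0 // mulVf // gt_eqF.
pose S := [set rnorm (C x) ^+ 2 | x in [set x | D x /\ rnorm x <= 1]].
have D0 : D 0 by have := DZ 0 _ Dx0; rewrite scale0r.
have hasS : has_sup S.
  split; first by exists (rnorm (C 0) ^+ 2), 0 => //; split => //; rewrite rnorm0.
  exists (r ^+ 2) => _ [x [_ x1] <-].
  rewrite ler_pXn2r ?nnegrE ?rnorm_ge0 ?(ltW r0) //.
  by apply: (le_trans (Cr x)); rewrite ler_piMr // ltW.
set c := sup S.
have CxS x : D x -> rnorm (C x) ^+ 2 <= c * rnorm x ^+ 2.
  move=> Dx; have [->|xN0] := eqVneq x 0.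
    by rewrite linear0 rnorm0 expr0n /= mulr0.
  have [Dn n1] := normal x Dx xN0; have x1 := rnorm_gt0 xN0.
  have : rnorm (C ((rnorm x)^-1%:C *: x)) ^+ 2 <= c.
    apply: ub_le_sup; first exact: hasS.2.
    by exists ((rnorm x)^-1%:C *: x) => //; split => //; rewrite n1.
  rewrite linearZ rnormZ ger0_norm ?invr_ge0 ?rnorm_ge0 // exprMn exprVn.
  by rewrite ler_pdivrMl ?exprn_gt0 // mulrC.
have c0 : 0 < c.
  have x00 : x0 != 0 by apply: contra Cx0 => /eqP ->; rewrite linear0.
  rewrite -(pmulr_lgt0 _ (exprn_gt0 2 (rnorm_gt0 x00))).
  by apply: lt_le_trans (CxS _ Dx0); rewrite exprn_gt0 // rnorm_gt0.
pose q : R := 2^-1; have q01 : 0 <= q < 1 by rewrite /q; apply/andP; split; lra.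
have [q0 q1] := andP q01.
have qn n : 0 < q ^+ n by rewrite exprn_gt0 // /q.
have hu n : exists x, [/\ D x, rnorm x <= 1 & c - (q ^+ n) ^+ 2 / c < rnorm (C x) ^+ 2].
  have e0 : 0 < (q ^+ n) ^+ 2 / c by rewrite divr_gt0 // exprn_gt0.
  by have [_ [x [Dx x1] <-] hx] := sup_adherent e0 hasS; exists x.
have {hu}[u uP] := choice hu.
have [|y hy] := Ccpt u; first by move=> n; have [] := uP n.
(* the slack (q ^+ n) ^+ 2 / c in the choice of u n makes |C^2 z - c z| at most q ^+ k *)
have near_y k : exists z, [/\ D z, rnorm (C z - y) <= q ^+ k,
    c - q ^+ k / c <= rnorm (C z) ^+ 2 & rnorm (C (C z) - c%:C *: z) <= q ^+ k].
  have [n kn ny] := hy k _ (qn k); exists (u n); have [Dn n1 hn] := uP n.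
  have qnk : q ^+ n <= q ^+ k by rewrite ler_wiXn2l // ltW.
  have qk1 : q ^+ k <= 1 by rewrite exprn_ile1 // ltW.
  have qn0 := qn n; have qk0 := qn k; split => //; first exact: ltW.
    apply: le_trans (ltW hn); rewrite lerD2l lerN2 ler_pM2r ?invr_gt0 //; nra.
  rewrite -(@ler_pXn2r _ 2) ?nnegrE ?rnorm_ge0 ?(ltW qk0) // -(ripxx (_ - _)) !ripE !ripxx.
  rewrite (ripC (u n)) Csym !ripxx.
  have := CxS _ (DC _ Dn); rewrite ltrBlDr -ltrBlDl ltr_pdivlMr // in hn.
  have : rnorm (u n) ^+ 2 <= 1 by rewrite expr_le1 ?rnorm_ge0.
  move=> h1 h2; have h3 := ler_wpM2l (ltW (mulr_gt0 c0 c0)) h1.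
  have h4 : (q ^+ n) ^+ 2 <= (q ^+ k) ^+ 2 by rewrite ler_pXn2r ?nnegrE ?(ltW qn0) ?(ltW qk0).
  nra.
have Dy : D y.
  apply/Dcl/closure_rnormP => e e0; have [k hk] := geometric_small 1 q01 e0.
  have [z [Dz zy _ _]] := near_y k; exists (C z); first exact: DC.
  by rewrite rnormB; rewrite mul1r in hk; exact: le_lt_trans hk.
have yN0 : y != 0.
  apply/eqP => y0; suff : c <= 0 by rewrite leNgt c0.
  apply: (@le_geometric_le0 q (1 + c^-1)) => // k.
  have [z [_ zy cz _]] := near_y k; rewrite y0 subr0 in zy.
  have qk0 := qn k; have qk1 : q ^+ k <= 1 by rewrite exprn_ile1 // ltW.
  rewrite mulrDl mul1r (mulrC c^-1).
  by have := rnorm_ge0 (C z); nra.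
have Cy : C (C y) = c%:C *: y.
  apply/eqP; rewrite -subr_eq0; apply/eqP/rnorm_le0.
  apply: (@le_geometric_le0 q (r * r + r + c)) => // k.
  have [z [_ zy _ cz]] := near_y k.
  have -> : C (C y) - c%:C *: y =
      C (C (y - C z)) + C (C (C z) - c%:C *: z) + c%:C *: (C z - y).
    rewrite !linearB [C (c%:C *: z)]linearZ; apply: rip_ext => w; rewrite !ripE; lra.
  apply: le_trans (rnormD _ _) _; rewrite rnormZ gtr0_norm // !mulrDl.
  apply: lerD; last by rewrite ler_pM2l.
  apply: le_trans (rnormD _ _) _; apply: lerD.
    apply: le_trans (Cr _) _; rewrite -mulrA ler_pM2l //.
    by apply: le_trans (Cr _) _; rewrite ler_pM2l // rnormB.
  by apply: le_trans (Cr _) _; rewrite ler_pM2l.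
have eigen t x : D x -> x != 0 -> C x = t%:C *: x ->
    exists e t, [/\ D e, rnorm e = 1 & C e = t%:C *: e].
  move=> Dx xN0 Cx; have [Dn n1] := normal x Dx xN0.
  exists ((rnorm x)^-1%:C *: x), t; split => //.
  by rewrite linearZ /= Cx !scalerA mulrC.
(* (C - s)(C + s) y = 0 with s ^+ 2 = c, so either y or (C + s) y is an eigenvector *)
set s := Num.sqrt c; have sE : s%:C * s%:C = c%:C :> R[i].
  by rewrite -rmorphM -expr2 sqr_sqrtr // ltW.
have [z0|zN0] := eqVneq (C y + s%:C *: y) 0.
  apply: (eigen (- s) y) => //; apply/eqP.
  by rewrite rmorphN scaleNr -addr_eq0 z0.
apply: (eigen s (C y + s%:C *: y)) => //.
  by apply: DD; [exact: DC | exact: DZ].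
by rewrite [LHS]linearD [C (s%:C *: y)]linearZ Cy scalerDr scalerA sE addrC.
Qed.

Lemma rip_closure0 (z : H) (D : set H) : (forall x, D x -> rip z x = 0) ->
  forall x, closure D x -> rip z x = 0.
Proof.
move=> h x /closure_rnormP xD; apply/eqP; rewrite -normr_le0.
apply/ler_addgt0Pr => e e0; rewrite add0r.
have z1 : 0 < rnorm z + 1 by rewrite ltr_wpDl // rnorm_ge0.
have [y Dy xy] := xD _ (divr_gt0 e0 z1).
rewrite -[x](subrK y) ripDr (h y) // addr0.
apply: (le_trans (rip_abs _ _)); rewrite ltr_pdivlMr // in xy.
by have := rnorm_ge0 z; have := rnorm_ge0 (x - y); nra.
Qed.

Lemma lspan_sub (E : set H) x : E x -> lspan E x.
Proof.
move=> Ex; exists [:: (1, x)]; rewrite big_seq1 scale1r; split => // p.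
by rewrite inE => /eqP ->.
Qed.

Lemma lspan0 (E : set H) : lspan E 0.
Proof. by exists [::]; rewrite big_nil. Qed.

Lemma lspanD (E : set H) x y : lspan E x -> lspan E y -> lspan E (x + y).
Proof.
move=> [s [sE ->]] [t [tE ->]]; exists (s ++ t); rewrite big_cat; split => // p.
by rewrite mem_cat => /orP[/sE|/tE].
Qed.

Lemma lspanZ (E : set H) (a : R[i]) x : lspan E x -> lspan E (a *: x).
Proof.
move=> [s [sE ->]]; exists [seq (a * p.1, p.2) | p <- s]; split.
  by move=> _ /mapP[p ps ->]; exact: (sE p).
by rewrite scaler_sumr big_map; apply: eq_bigr => p _; rewrite scalerA.
Qed.

(** A maximal orthonormal set [E] of eigenvectors exists by Zorn.  If its span were not dense,
    the orthogonal complement of [E] would be nonzero, closed and invariant under [C], and so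
    would contain one more eigenvector. *)
Lemma hilbert_schmidt (C : {linear H -> H}) :
    continuous C -> symmetric_op C -> seq_compact_op C -> (forall x, C x = 0 -> x = 0) ->
  exists E, orthonormal_basis ip E /\ forall e, E e -> exists t, C e = t%:C *: e.
Proof.
move=> Cc Csym Ccpt Cinj.
pose P (E : set H) := [/\ forall x, E x -> ip x x = 1,
  forall x y, E x -> E y -> x <> y -> ip x y = 0 &
  forall x, E x -> exists t, C x = t%:C *: x].
have [|E [[E1 E0 EC] Emax]] := @Zorn_bigcup _ P.
  move=> F FP Ftot; split.
  - by move=> x [A FA Ax]; have [+ _ _] := FP _ FA; exact.
  - move=> x y [A FA Ax] [B FB By] xy.
    have [AB|BA] := Ftot _ _ FA FB.
      by have [_ + _] := FP _ FB; apply => //; exact: AB.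
    by have [_ + _] := FP _ FA; apply => //; exact: BA.
  - by move=> x [A FA Ax]; have [_ _ +] := FP _ FA; exact.
exists E; split => //; split => //; apply/seteqP; split => // x0 _.
apply: contrapT => x0E.
have [| | | | | |a aE ha] := @quadratic_minimizer (lspan E) (fun h => rip h x0) (rnorm x0).
- exact: lspan0.
- exact: lspanD.
- by move=> t x; exact: lspanZ.
- by move=> x y /=; rewrite ripDl.
- by move=> t x; rewrite ripZl.
- by move=> x; rewrite mulrC rip_le.
(* a is the projection of x0 onto the closed span of E, so x0 - a is orthogonal to E *)
pose y := x0 - a; have yN0 : y != 0.
  by rewrite subr_eq0; apply/eqP => xa; apply: x0E; rewrite xa.
have ip0 e x : ip e x = 0 <-> rip e x = 0 /\ rip e ('i *: x) = 0.
  split=> [h|[h1 h2]]; first by rewrite rip_ir /rip h.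
  by rewrite -(linear0r ip e); apply: ip_eq; rewrite ?scaler0 rip0r.
pose D := [set x | forall e, E e -> ip e x = 0].
have [| | | | | | | |e [t [De e1 Ce]]] := @compact_eigenvector C D => //.
- by move=> u v Du Dv e Ee; rewrite linearDr /= Du // Dv // addr0.
- by move=> t u Du e Ee; rewrite linearZr_LR /= Du // mulr0.
- move=> u uD e Ee; apply/ip0; split.
    by apply: (rip_closure0 _ uD) => v /(_ _ Ee)/ip0[].
  rewrite -[rip _ _]opprK -rip_iC; apply/eqP; rewrite oppr_eq0; apply/eqP.
  by apply: (rip_closure0 _ uD) => v /(_ _ Ee)/ip0[_ h2]; rewrite rip_iC h2 oppr0.
- move=> u Du e Ee; rewrite -symmetric_op_ip //.
  by have [t ->] := EC _ Ee; rewrite linearZl_LR /= Du // mulr0.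
- exists y; last by apply: contra yN0 => /eqP/Cinj ->.
  move=> e Ee; apply/ip0; rewrite ripBr (ha e) ?subrr; last exact: lspan_sub.
  split => //; rewrite -[rip _ _]opprK -rip_iC ripBr ha ?subrr ?oppr0 //.
  exact/lspanZ/lspan_sub.
have ee : ip e e = 1 by rewrite -ip_norm normE e1 expr1n.
have eE : ~ E e by move=> /De; rewrite ee => /eqP; rewrite oner_eq0.
apply: (Emax (E `|` [set e])).
  split=> [x Ex|h]; first by left.
  by apply: eE; apply: h; right.
have De' x : E x -> ip e x = 0 by move=> /De h; rewrite ipC h conjc0.
split.
- by move=> x [/E1|->].
- move=> x z [Ex|->] [Ez|->] //; first by move=> xz; exact: E0.
    by move=> _; exact: De.
  by move=> _; exact: De'.
- by move=> x [/EC|->] //; exists t.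
Qed.

(** * Graphs of operators *)

Lemma ginvK (A : set (H * H)) : ginv (ginv A) = A.
Proof. by apply/seteqP; split=> -[x y]. Qed.

Lemma ginv_cancel (f g : H -> H) : cancel f g -> cancel g f ->
  ginv (graph_of f) = graph_of g.
Proof.
move=> fK gK; apply/seteqP; split=> -[x y]; rewrite /ginv /graph_of /=.
  by move=> ->; rewrite fK.
by move=> ->; rewrite gK.
Qed.

Lemma graph_bounded_operator (f : {linear H -> H}) : continuous f -> bounded_operator (graph_of f).
Proof. by exists f. Qed.

Lemma correct_operator_inverse (A : set (H * H)) : correct_operator A ->
  exists G : {linear H -> H}, continuous G /\ ginv A = graph_of G.
Proof.
move=> [[A0 Alin _] [c c0 Ac] Aran].
have Auniq u v y : A (u, y) -> A (v, y) -> u = v.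
  move=> Au Av; have := Alin (-1) _ _ Av Au.
  rewrite scaleN1r => /Ac; rewrite /= addNr normr0 mulr0 normr_le0 addrC subr_eq0.
  by move/eqP.
have /choice[G0 AG] : forall y, exists u, A (u, y).
  move=> y; have : gran A y by rewrite Aran.
  by move=> [[u y'] Au /= <-]; exists u.
have lG : linear G0.
  by move=> a x y; exact: Auniq (AG _) (Alin a _ _ (AG x) (AG y)).
have [G GE] := linear_bundle lG; exists G; split.
  apply: (@bounded_continuous _ (complex.Re c)) => x.
  have cE : c = (complex.Re c)%:C by rewrite RRe_real // gtr0_real.
  by have := Ac _ _ (AG x); rewrite -GE !normE {1}cE -rmorphM lecR.
rewrite GE; apply/seteqP; split=> -[x y]; rewrite /ginv /graph_of /=.
  by move=> h; exact: Auniq h (AG x).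
by move=> ->.
Qed.

(** A bounded operator is determined by a dense domain: its graph is closed, and the graph over
    the domain is dense in it. *)
Lemma closure_graph (D : set H) (B : {linear H -> H}) : dense D -> continuous B ->
  closure [set p : H * H | D p.1 /\ p.2 = B p.1] = graph_of B.
Proof.
move=> /dense_rnormP Dd /continuous_bounded[r r0 Br].
apply/seteqP; split=> -[x y]; rewrite /graph_of /=.
  move=> cxy; apply/eqP; rewrite -subr_eq0; apply/eqP/rnorm_le0.
  apply/ler_addgt0Pr => e e0; rewrite add0r.
  have [s s0 sE] : exists2 s, 0 < s & s * (1 + r) = e.
    by exists (e / (1 + r)); rewrite ?divr_gt0 ?divfK ?gt_eqF // addr_gt0.
  have s0' : 0 < s%:C :> R[i] by rewrite ltcR.
  have [[u v] [/= [_ ->]]] := cxy _ (nbhsx_ballx (x, y) _ s0').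
  move=> [/(ballE _ _ s0') /= xu /(ballE _ _ s0') /= yu].
  have := rnormD (y - B u) (B (u - x)); rewrite linearB addrA subrK.
  have := Br (u - x); rewrite linearB (rnormB u); have := rnorm_ge0 (x - u).
  have := ler_wpM2l (ltW r0) (ltW xu); lra.
move=> -> V /nbhs_ballP[e /= e0 eV].
have eE : e = (complex.Re e)%:C by rewrite RRe_real // gtr0_real.
have e0' : 0 < complex.Re e by rewrite -ltcR -eE.
have s0 : 0 < complex.Re e / (1 + r) by rewrite divr_gt0 // addr_gt0.
have [u Du] := Dd x _ s0; rewrite ltr_pdivlMr ?addr_gt0 // => xu.
exists (u, B u); split => //; apply: eV; split; apply/(ballE _ _ e0) => /=.
  by have := rnorm_ge0 (x - u); nra.
rewrite -linearB; apply: le_lt_trans (Br _) _.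
by have := rnorm_ge0 (x - u); nra.
Qed.

(** A pair [(x, y)] is in the adjoint of [C^-1] exactly when [(z, x) = (C z, y)] for all [z],
    that is, when [x = C y]. *)
Lemma self_adjoint_ginv (C : {linear H -> H}) : symmetric_op C ->
    (forall x, C x = 0 -> x = 0) -> dense (range C) ->
  self_adjoint ip (ginv (graph_of C)).
Proof.
move=> Csym Cinj Cd; rewrite /ginv /graph_of; split.
- split=> /=; first by rewrite linear0.
    by move=> a [u v] [u' v'] /= -> ->; rewrite linearP.
  by move=> v /esym/Cinj.
- rewrite /densely_defined; congr (dense _): Cd; apply/seteqP; split=> x /=.
    by move=> [y _ <-]; exists (C y, y).
  by move=> [[u v] /= -> <-]; exists v.
apply/seteqP; split=> -[x y] /=.
  move=> h; apply: ip_ext => z; rewrite /= in h.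
  by rewrite (h (C z) z) // symmetric_op_ip.
by move=> -> u v /= ->; rewrite symmetric_op_ip.
Qed.

(** * Inverses of operators similar to a bounded symmetric operator *)

Section Similarity.
Variables (T T' C : {linear H -> H}).
Hypotheses (Tc : continuous T) (T'c : continuous T').
Hypotheses (TK : cancel T T') (T'K : cancel T' T).
Hypotheses (Cc : continuous C) (Csym : symmetric_op C).
Hypothesis Cinj : forall x, C x = 0 -> x = 0.
Let A := ginv (graph_of (fun x => T' (C (T x)))).

Lemma similar_ginv : similar_operators A (ginv (graph_of C)).
Proof.
exists (graph_of T'); rewrite /boundedly_invertible (ginv_cancel T'K TK).
split; [exact: graph_bounded_operator | exact: graph_bounded_operator |].
rewrite /A /ginv /graph_of /gcomp; apply/seteqP; split=> -[u v] /=.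
  by move=> ->; exists (T v) => //=; exists (C (T v)) => /=; rewrite ?T'K.
by move=> [y [z /= -> zE] ->]; rewrite T'K -zE TK.
Qed.

(** Up to the similarity [T], [(C^-1 - z)^-1 = C (I - z C)^-1], and for nonreal [z],
    [I - z C = - z (C - z^-1)] is invertible by [nonreal_resolvent]. *)
Lemma spectrum_similar_real : spectrum A `<=` [set z : R[i] | z \is Num.real].
Proof.
move=> z; apply: contra_notT => zNreal; rewrite /resolvent_set /=.
have z0 : z != 0 by apply: contra zNreal => /eqP ->.
have Im_z : complex.Im z^-1 != 0.
  apply: contra zNreal => /eqP h; rewrite -realV.
  by case: (z^-1) h => a b /= ->; rewrite complex_real.
have [g [gc gK Kg]] := nonreal_resolvent Cc Csym Im_z.
pose J : {linear H -> H} := T' \o (C \o ((- z^-1) \*: (g \o T))).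
have JE y : J y = T' (C (- z^-1 *: g (T y))) by [].
have Jc : continuous J.
  have [r1 r10 h1] := continuous_bounded Tc.
  have [r2 r20 h2] := continuous_bounded gc.
  have [r3 r30 h3] := continuous_bounded Cc.
  have [r4 r40 h4] := continuous_bounded T'c.
  apply: (@bounded_continuous _ (r4 * (r3 * (complex.Re `|- z^-1| * (r2 * r1))))) => y.
  rewrite JE -!mulrA; apply: (le_trans (h4 _)); rewrite ler_pM2l //.
  apply: (le_trans (h3 _)); rewrite ler_pM2l // rnormZC ler_wpM2l //.
    by rewrite -ler0c RRe_real.
  by apply: (le_trans (h2 _)); rewrite ler_pM2l.
exists J; split => //; rewrite /A /ginv /graph_of /gadd.
apply/seteqP; split=> -[y u] /=; rewrite ?JE.
  move=> [a [_ [uE -> ->]]]; rewrite uE; congr (T' (C _)).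
  rewrite linearD linearN linearZ /= T'K.
  rewrite -{1}[T a](gK (T a)).
  have -> : T a - z *: C (T a) = - z *: (C (T a) - z^-1 *: T a).
    by rewrite scalerBr scalerA mulNr mulfV // scaleN1r opprK scaleNr addrC.
  by rewrite [g (- z *: _)]linearZ /= scalerA mulrNN mulVf // scale1r.
move=> uE; exists (T' (- z^-1 *: g (T y))), (- (z *: u)); rewrite T'K uE; split => //.
apply: (can_inj TK).
rewrite [T (_ + _)]linearD [T (- (z *: _))]linearN [T (z *: _)]linearZ /= !T'K.
have := Kg (T y); set w := g (T y) => <-.
rewrite [C (_ *: _)]linearZ /= scalerA mulrN mulfV // scaleN1r opprK.
by rewrite scaleNr addrC.
Qed.

(** [T'] maps an orthonormal basis of eigenvectors of [C] to the required Riesz basis; the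
    eigenvalues of [C] are nonzero by injectivity, and are inverted in [A]. *)
Lemma riesz_basis_similar : seq_compact_op C ->
  exists F, riesz_basis ip F /\ F `<=` eigenvector A.
Proof.
move=> Ccpt; have [E [Eb EC]] := hilbert_schmidt Cc Csym Ccpt Cinj.
exists (T' @` E); split.
  exists E, T'; split => //; rewrite /boundedly_invertible (ginv_cancel T'K TK).
  exact: graph_bounded_operator.
have [E1 _ _] := Eb.
move=> _ [e Ee <-]; have eN0 : e <> 0.
  by move=> e0; have := E1 _ Ee; rewrite e0 linear0r => /eqP; rewrite eq_sym oner_eq0.
split; first by move=> h; apply: eN0; rewrite -(T'K e) h linear0.
have [t Ce] := EC _ Ee; exists (t%:C)^-1.
have t0 : t%:C != 0 :> R[i].
  by apply/eqP => t0; apply/eN0/Cinj; rewrite Ce t0 scale0r.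
rewrite /A /ginv /graph_of /= linearZ /= T'K linearZ /= Ce.
by rewrite scalerA mulVf // scale1r.
Qed.

End Similarity.

(** * The operators G P and P G *)

Lemma compact_operator_seq (G : {linear H -> H}) :
  compact_operator (graph_of G) -> seq_compact_op G.
Proof.
move=> [_]; rewrite precompactE => cpt u u1.
set S := (X in closure X) in cpt.
have Gu n : S (G (u n)).
  by exists (u n, G (u n)) => //; split => //=; rewrite normE lecR.
have [|y [_ cy]] := cpt ((G \o u) @ \oo) _.
  by exists 0%N => // n _ /=; exact: subset_closure.
exists y => m e e0; have e0' : 0 < e%:C :> R[i] by rewrite ltcR.
have [|_ [[n /= mn <-] /(ballE _ _ e0') yn]] :=
    cy ((G \o u) @` [set n | (m <= n)%N]) _ _ (nbhsx_ballx y _ e0').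
  by exists m => // n mn /=; exists n.
by exists n => //; rewrite rnormB.
Qed.

Lemma seq_compact_sandwich (T G : {linear H -> H}) : continuous T ->
  seq_compact_op G -> seq_compact_op (fun x => T (G (T x))).
Proof.
move=> /continuous_bounded[r r0 Tr] Gc u u1.
have rV : `|r^-1| = r^-1 by rewrite gtr0_norm // invr_gt0.
have [|y hy] := Gc (fun n => r^-1%:C *: T (u n)).
  move=> n; rewrite rnormZ rV ler_pdivrMl // mulr1.
  by apply: le_trans (Tr _) _; rewrite ger_pMr.
exists (r%:C *: T y) => m e e0.
have [n mn hn] := hy m _ (divr_gt0 e0 (mulr_gt0 r0 r0)).
exists n => //.
have -> : T (G (T (u n))) - r%:C *: T y = r%:C *: T (G (r^-1%:C *: T (u n)) - y).
  rewrite [T (_ - _)]linearB [G (_ *: _)]linearZ [T (_ *: _)]linearZ scalerBr /= scalerA.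
  by rewrite -rmorphM mulfV ?gt_eqF // scale1r.
rewrite rnormZ gtr0_norm //; rewrite ltr_pdivlMr ?mulr_gt0 // in hn.
apply: le_lt_trans hn; set w := _ - y.
by have := Tr w; rewrite -(ler_pM2l r0); lra.
Qed.

(** [B] is the bounded closure of [K G^-1].  The last hypothesis says that the range of [K^*]
    lies in that of [G]; so [K^* = G W], and [(K x, y) = (G x, W y)] shows that the vectors
    [K x] with [|G x| <= 1] are weakly bounded, hence bounded.  By density of the range of [G]
    this bounds [W], and [B = W^*]. *)
Lemma bounded_left_quotient (G K : {linear H -> H}) :
    continuous K -> symmetric_op G -> (forall x, G x = 0 -> x = 0) -> dense (range G) ->
    (forall y z, (forall x, rip (K x) y = rip x z) -> range G z) ->
  exists B : {linear H -> H}, continuous B /\ forall x, B (G x) = K x.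
Proof.
move=> Kc Gsym Ginj /dense_rnormP Gd KG.
have [Ks [_ KsE]] := adjoint_exists Kc.
have /choice[W0 WE] : forall y, exists w, G w = Ks y.
  by move=> y; have [x|w _ Gw] := KG y (Ks y); [exact: KsE | exists w].
have Ginj' x y : G x = G y -> x = y.
  move=> Gxy; apply/eqP; rewrite -subr_eq0; apply/eqP/Ginj.
  by rewrite linearB Gxy subrr.
have lW : linear W0 by move=> a x y; apply: Ginj'; rewrite linearP !WE linearP.
have [W WW0] := linear_bundle lW; rewrite -WW0 in WE.
have KW x y : rip (K x) y = rip (G x) (W y) by rewrite KsE -WE Gsym.
have [m Km] : exists m, forall g, (exists2 x, rnorm (G x) <= 1 & g = K x) -> rnorm g <= m.
  apply: weakly_bounded => y; exists (rnorm (W y)) => _ [x x1 ->].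
  rewrite KW; apply: (le_trans (rip_abs _ _)).
  by rewrite ler_piMl ?rnorm_ge0.
have m0 : 0 <= m by apply: le_trans (rnorm_ge0 0) (Km _ _); exists 0; rewrite ?linear0 ?rnorm0.
have KmG x : rnorm (K x) <= m * rnorm (G x).
  have [Gx0|GxN0] := eqVneq (G x) 0; first by rewrite (Ginj _ Gx0) !linear0 rnorm0 mulr0.
  have g0 := rnorm_gt0 GxN0.
  have : rnorm (K ((rnorm (G x))^-1%:C *: x)) <= m.
    apply: Km; exists ((rnorm (G x))^-1%:C *: x) => //.
    by rewrite linearZ rnormZ gtr0_norm ?invr_gt0 // mulVf // gt_eqF.
  by rewrite linearZ rnormZ gtr0_norm ?invr_gt0 // ler_pdivrMl // mulrC.
have Wm y : rnorm (W y) <= m * rnorm y.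
  apply: rnorm_le_rip => [|z]; first by rewrite mulr_ge0 // rnorm_ge0.
  apply/ler_addgt0Pr => e e0.
  have c0 : 0 < rnorm (W y) + m * rnorm y + 1.
    by rewrite ltr_wpDl // addr_ge0 ?mulr_ge0 ?rnorm_ge0.
  have [_ [x _ <-]] := Gd z _ (divr_gt0 e0 c0); rewrite ltr_pdivlMr // => zx.
  have h1 : rip (W y) (G x) <= m * rnorm (G x) * rnorm y.
    rewrite ripC -KW; apply: le_trans (rip_le _ _) _.
    by rewrite ler_wpM2r ?rnorm_ge0.
  have h2 := rip_le (W y) (z - G x); rewrite ripBr in h2.
  have h3 : rnorm (G x) <= rnorm z + rnorm (z - G x).
    by have := rnormD z (G x - z); rewrite addrC subrK (rnormB (G x)).
  have h4 : m * rnorm (G x) * rnorm y <= m * (rnorm z + rnorm (z - G x)) * rnorm y.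
    by rewrite ler_wpM2r ?rnorm_ge0 // ler_wpM2l.
  by have := rnorm_ge0 (z - G x); nra.
have [B [Bc BE]] := adjoint_exists (bounded_continuous Wm).
exists B; split => // x; apply: rip_ext => y.
by rewrite KW ripC -BE ripC.
Qed.

(** With [P = T^2], [G P = T^-1 (T G T) T], which reduces the claims to the symmetric operator
    [T G T]. *)
Lemma ginv_product_similar (P G : {linear H -> H}) r :
    0 < r -> (forall x, r * rnorm x ^+ 2 <= rip (P x) x) ->
    continuous P -> symmetric_op P -> continuous G -> symmetric_op G ->
    (forall x, G x = 0 -> x = 0) -> dense (range G) ->
  let A := ginv (graph_of (fun x => G (P x))) in
  [/\ exists B, self_adjoint ip B /\ similar_operators A B,
      spectrum A `<=` [set z : R[i] | z \is Num.real] &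
      compact_operator (graph_of G) ->
        exists F, riesz_basis ip F /\ F `<=` eigenvector A].
Proof.
move=> r0 Pr Pc Psym Gc Gsym Ginj /dense_rnormP Gd.
have [T [T' [[Tc T'c] TK T'K Tsym TT]]] := positive_sqrt r0 Pr Pc Psym.
have [C CE] : exists C : {linear H -> H}, forall x, C x = T (G (T x)).
  by exists (T \o (G \o T)).
have [t t0 Tt] := continuous_bounded Tc.
have [g g0 Gg] := continuous_bounded Gc.
have Cc : continuous C.
  apply: (@bounded_continuous _ (t * (g * t))) => x; rewrite CE -!mulrA.
  apply: le_trans (Tt _) _; rewrite ler_pM2l //.
  by apply: le_trans (Gg _) _; rewrite ler_pM2l.
have Csym : symmetric_op C by move=> x y; rewrite !CE Tsym Gsym Tsym.
have T0 x : T x = 0 -> x = 0 by move=> Tx; rewrite -(TK x) Tx linear0.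
have Cinj x : C x = 0 -> x = 0 by rewrite CE => /T0/Ginj/T0.
have Cd : dense (range C).
  move=> U [z Uz] Uo.
  have [e e0 eU] : exists2 e : R, 0 < e & forall x, rnorm (z - x) < e -> U x.
    have [e /= e0 eU] := (nbhs_ballP _ _).1 (open_nbhs_nbhs (conj Uo Uz)).
    exists (complex.Re e) => [|x zx]; last by apply: eU; apply/ballE.
    by rewrite -ltcR RRe_real // gtr0_real.
  have [_ [w _ <-] hw] := Gd (T' z) _ (divr_gt0 e0 t0).
  exists (C (T' w)); split; last by exists (T' w).
  apply: eU; rewrite CE T'K -{1}(T'K z) -linearB.
  by apply: le_lt_trans (Tt _) _; rewrite mulrC -ltr_pdivlMr.
have -> : (fun x => G (P x)) = (fun x => T' (C (T x))).
  by apply/funext => x; rewrite CE TK TT.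
split.
- by exists (ginv (graph_of C)); split; [exact: self_adjoint_ginv | exact: similar_ginv].
- exact: spectrum_similar_real.
move=> /compact_operator_seq/(seq_compact_sandwich Tc) Ccpt.
apply: riesz_basis_similar => // u /Ccpt[y hy].
by exists y => m e /(hy m)[n ? ?]; exists n; rewrite ?CE.
Qed.

Lemma adjoint_ginv_product (P G : {linear H -> H}) : symmetric_op P -> symmetric_op G ->
  adjoint ip (ginv (graph_of (fun x => P (G x)))) = ginv (graph_of (fun x => G (P x))).
Proof.
move=> Psym Gsym; apply/seteqP; split=> -[x y]; rewrite /adjoint /ginv /graph_of /=.
  move=> h; apply: ip_ext => z.
  by rewrite (h _ _ (erefl _)) !symmetric_op_ip.
by move=> -> u v /= ->; rewrite !symmetric_op_ip.
Qed.

Lemma ge0_ReIm (z : R[i]) : 0 <= z -> 0 <= complex.Re z /\ complex.Im z = 0.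
Proof. by rewrite lecE /= => /andP[/eqP -> ->]. Qed.

(** Each [(G y, y)] lies in [A], hence in its adjoint. *)
Lemma self_adjoint_inverse_symmetric (A : set (H * H)) (G : {linear H -> H}) :
  adjoint ip A = A -> ginv A = graph_of G -> symmetric_op G.
Proof.
move=> Asa AG x y.
have AGx z : A (G z, z) by have : graph_of G (z, G z) by []; rewrite -AG.
have := AGx y; rewrite -Asa => /(_ _ _ (AGx x)) /= h.
by rewrite /rip h.
Qed.

End RealStructure.

Theorem corollary1p4 (R : realType) (H : completeNormedModType R[i])
    (ip : {dot H for Num.conj}) (ip_norm : forall x : H, `|x| ^+ 2 = ip x x)
    (L0 Lhat L LK : set (H * H)) (K : {linear H -> H})
    (L0_sym : symmetric_operator ip L0) (L0_min : minimal_operator L0)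
    (Lhat_def : Lhat = adjoint ip L0) (Lhat_max : maximal_operator Lhat)
    (L_ext : correct_extension L L0) (L_sa : self_adjoint ip L)
    (LK_restr : correct_restriction LK Lhat)
    (K_bounded : continuous K) (K_ker : range K `<=` gker Lhat)
    (LK_inv : ginv LK = gadd (ginv L) (graph_of K))
    (Kadj_dom : gran (adjoint ip (graph_of K)) `<=` gdom L) :
  let LKadj := adjoint ip LK in
  (* the closure of the operator K L, and I + K L *)
  let KL : set (H * H) := closure (gcomp (graph_of K) L) in
  let IKL := gadd (gid H) KL in
  [/\ nonneg_operator ip IKL -> boundedly_invertible IKL ->
        exists A, self_adjoint ip A /\ similar_operators LKadj A,
      nonneg_operator ip IKL -> boundedly_invertible IKL ->
        spectrum LKadj `<=` [set z : R[i] | z \is Num.real],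
      nonneg_operator ip IKL -> boundedly_invertible IKL -> compact_operator (ginv L) ->
        exists F, riesz_basis ip F /\ F `<=` eigenvector LKadj &
      nonneg_operator ip KL ->
        exists A, self_adjoint ip A /\ similar_operators LKadj A].
Proof.
move=> LKadj KL IKL.
have [[_ _ L00] L_dense L_adj] := L_sa.
have [G [Gc LG]] := correct_operator_inverse L_ext.2.
have LE u v : L (u, v) <-> u = G v by rewrite -[L _]/(ginv L (v, u)) LG.
have Gsym := self_adjoint_inverse_symmetric L_adj LG.
have Ginj x : G x = 0 -> x = 0 by move=> Gx; apply: L00; apply/LE.
have domE : gdom L = range G.
  apply/seteqP; split=> u /=; first by move=> [[u' v] /LE -> /= <-]; exists v.
  by move=> [v _ <-]; exists (G v, v) => //; apply/LE.
have G_dense : dense (range G) by rewrite -domE.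
have [B [Bc BG]] : exists B : {linear H -> H}, continuous B /\ forall x, B (G x) = K x.
  apply: (bounded_left_quotient ip_norm) => // y z Kyz; rewrite -domE; apply: Kadj_dom.
  exists (y, z) => // u v; rewrite /graph_of /= => ->.
  exact: rip_adjoint_ip.
have KLE : KL = graph_of B.
  rewrite /KL -(closure_graph G_dense Bc); congr closure.
  apply/seteqP; split=> -[u v]; rewrite /gcomp /graph_of /=.
    by move=> [y /LE -> ->]; split; [exists y | rewrite BG].
  by move=> [[y _ <-] ->]; exists y; [apply/LE | rewrite BG].
have [P PE] : exists P : {linear H -> H}, forall x, P x = x + B x.
  by exists (idfun \+ B).
have IKLE : IKL = graph_of P.
  rewrite /IKL KLE; apply/seteqP; split=> -[u v]; rewrite /gadd /gid /graph_of /=.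
    by move=> [_ [_ [-> -> ->]]]; rewrite PE.
  by move=> ->; exists u, (B u); rewrite PE.
have [b b0 Bb] := continuous_bounded Bc.
have Pc : continuous P.
  apply: (@bounded_continuous _ _ _ (1 + b)) => x; rewrite PE mulrDl mul1r.
  by apply: le_trans (rnormD _ _) _; rewrite lerD2l.
have LKE : LK = ginv (graph_of (fun x => P (G x))).
  rewrite -[LK]ginvK LK_inv LG; congr ginv.
  apply/seteqP; split=> -[u v]; rewrite /gadd /graph_of /=.
    by move=> [_ [_ [-> -> ->]]]; rewrite PE BG.
  by move=> ->; exists (G u), (K u); rewrite PE BG.
have Psym_of : (forall x, 0 <= ip (P x) x) -> symmetric_op ip P.
  move=> P0; apply: (symmetric_op_of_real (ip := ip)) => x.
  by rewrite rip_ir; exact: (ge0_ReIm (P0 x)).2.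
pose conclusions := [/\ exists A, self_adjoint ip A /\ similar_operators LKadj A,
  spectrum LKadj `<=` [set z : R[i] | z \is Num.real] &
  compact_operator (ginv L) ->
    exists F, riesz_basis ip F /\ F `<=` eigenvector LKadj].
have coercive_case r : 0 < r -> (forall x, r * rnorm x ^+ 2 <= rip ip (P x) x) ->
    symmetric_op ip P -> conclusions.
  move=> r0 Pr Psym; rewrite /conclusions /LKadj LKE adjoint_ginv_product // LG.
  exact: ginv_product_similar Pr _ _ _ _ _ _.
have invertible_case : nonneg_operator ip IKL -> boundedly_invertible IKL -> conclusions.
  rewrite IKLE => P0 [Q [Qc PQ]].
  have {}P0 x : 0 <= ip (P x) x by exact: P0.
  have [s s0 Qs] := continuous_bounded Qc.
  have QP x : Q (P x) = x.
    by have : ginv (graph_of P) (P x, x) by []; rewrite PQ.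
  have Psym := Psym_of P0.
  have [|x|r r0 Pr] := nonneg_invertible_coercive ip_norm s0 _ Pc Psym.
  - by move=> x; rewrite -{1}(QP x).
  - exact: (ge0_ReIm (P0 x)).1.
  exact: coercive_case r0 Pr Psym.
split; [by move=> h1 h2; case: (invertible_case h1 h2) .. | ].
rewrite KLE => B0.
have {}B0 x : 0 <= ip (B x) x by exact: B0.
have P0 x : 0 <= ip (P x) x by rewrite PE linearDl /= addr_ge0 // dnorm_ge0.
have [|//] := coercive_case 1 ltr01 _ (Psym_of P0).
move=> x; rewrite mul1r PE ripDl ripxx // lerDl.
exact: (ge0_ReIm (B0 x)).1.
Qed.
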